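(* Let $t \ge 3$ and $m, n \ge 1$ be integers. Then $M_t(K_{m,n})$ is a distance magic graph if and only if $m = n = 2$.
   Context: $K_{m,n}$ is the complete bipartite graph with parts of sizes $m$ and $n$. For a graph $G=(V,E)$ and an integer $t \ge 1$, the generalised Mycielskian $M_t(G)$ is the graph with vertex set $(V \times \{0,1,\dots,t-1\}) \cup \{u\}$ (where $u$ is a new vertex), whose edges are: $(x,0)(y,0)$ for every edge $xy \in E$; $(x,i)(y,i+1)$ for every $0 \le i \le t-2$ and every ordered pair $(x,y)$ with $xy \in E$; and $(x,t-1)u$ for every $x \in V$. A graph $H$ on $N$ vertices is distance magic if there is a bijection $f: V(H) \to \{1,2,\dots,N\}$ and a constant $k$ such that for every vertex $v$, $\sum_{w \in N(v)} f(w) = k$, where $N(v)$ is the open neighbourhood of $v$. *)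

(* Defs.v *)
From mathcomp Require Import all_boot.

Set Implicit Arguments.
Unset Strict Implicit.
Unset Printing Implicit Defensive.

Record sgraph := SGraph {
  vertex :> finType;
  adj : rel vertex;
  adj_sym : symmetric adj;
  adj_irr : irreflexive adj
}.

Definition K_rel (m n : nat) : rel ('I_m + 'I_n) :=
  fun x y => match x, y with
             | inl _, inr _ | inr _, inl _ => true
             | _, _ => false
             end.

Lemma K_sym m n : symmetric (@K_rel m n).
Proof. by case=> ? []. Qed.

Lemma K_irr m n : irreflexive (@K_rel m n).
Proof. by case. Qed.

Definition complete_bipartite (m n : nat) : sgraph :=
  SGraph (@K_sym m n) (@K_irr m n).

(* [None] is the apex u, and [Some (x, i)] is the copy (x, i) of x at level i. *)
Definition myc_rel (t : nat) (G : sgraph) : rel (option (G * 'I_t)) :=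
  fun a b => match a, b with
             | Some (x, i), Some (y, j) =>
                 adj x y && [|| (i == 0 :> nat) && (j == 0 :> nat),
                                j == i.+1 :> nat | i == j.+1 :> nat]
             | Some (_, i), None | None, Some (_, i) => i.+1 == t
             | None, None => false
             end.

Lemma myc_sym t G : symmetric (@myc_rel t G).
Proof.
case=> [[x i]|] [[y j]|] //=.
by rewrite adj_sym (andbC (i == 0 :> nat)) (orbC (j == i.+1 :> nat)).
Qed.

Lemma myc_irr t G : irreflexive (@myc_rel t G).
Proof. by case=> [[x i]|] //=; rewrite adj_irr. Qed.

Definition mycielskian (t : nat) (G : sgraph) : sgraph :=
  SGraph (@myc_sym t G) (@myc_irr t G).

(* The ordinals of ['I_#|H|] start at 0, so the label of [w] is [(f w).+1]. *)
Definition distance_magic (H : sgraph) : Prop :=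
  exists f : H -> 'I_#|H|, bijective f /\
  exists k : nat, forall v : H, \sum_(w : H | adj v w) (f w).+1 = k.

(* Main.v *)
Require Import Defs.
From mathcomp Require Import all_boot.
From mathcomp Require Import zify.

(** Every neighbourhood in M_t(K_{m,n}) is a union of two classes, a class being
    one side of K_{m,n} at one level, or the apex alone.  The weight equations
    force every class, including the apex, to have the same sum s.  A part of
    size one would then repeat the label of the apex, and s <= N together with
    (2t+1)s = N(N+1)/2 gives m + n <= 4.  For m = n = 2 give the apex the label
    N and fill the 2t remaining classes with the pairs {p, N - p}. *)

Definition side {m n : nat} (x : complete_bipartite m n) : bool :=
  if x is inl _ then false else true.

(** The level [j] is a [nat], not an ordinal, so that [i.-1] and [i.+1] need no bound proofs; a
    class with [t <= j] is empty. *)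
Definition in_class {t m n : nat} (b : bool) (j : nat)
    (w : mycielskian t (complete_bipartite m n)) : bool :=
  if w is Some (x, i) then (side x == b) && (i == j :> nat) else false.

Definition class_sum {t m n : nat}
    (F : mycielskian t (complete_bipartite m n) -> nat) (b : bool) (j : nat) :=
  \sum_(w | in_class b j w) F w.

(** Adding truth values as numbers expresses disjointness and covering at once, in a form that [lia]
    can check pointwise. *)
Lemma sum_pred_split (T : finType) (P Q R : pred T) (F : T -> nat) :
  (forall w, P w = Q w + R w :> nat) ->
  \sum_(w | P w) F w = \sum_(w | Q w) F w + \sum_(w | R w) F w.
Proof.
move=> PQR; rewrite big_mkcond [X in _ = X + _]big_mkcond.
rewrite [X in _ = _ + X]big_mkcond -big_split; apply: eq_bigr => w _ /=.
by have := PQR w; do 3 case: ifP => _; lia.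
Qed.

Lemma sum_index_bij (T : finType) (f : T -> 'I_#|T|) :
  bijective f -> 2 * \sum_w (f w).+1 = #|T| * #|T|.+1.
Proof.
case=> g fK gK.
have -> : \sum_w (f w).+1 = \sum_(i < #|T|) i.+1.
  by rewrite (reindex f) //; exists g => ? _.
elim: #|T| => [|N IH]; first by rewrite big_ord0.
by rewrite big_ord_recr mulnDr /= IH; lia.
Qed.

(* At the bottom level [i.-1 = i = 0], which is where the edges inside level 0
   are accounted for. *)
Lemma weight_vertex {t m n : nat}
    (F : mycielskian t (complete_bipartite m n) -> nat)
    (x : complete_bipartite m n) (i : 'I_t) :
  \sum_(w | @adj (mycielskian t (complete_bipartite m n)) (Some (x, i)) w) F w =
  class_sum F (~~ side x) i.-1 +
  (if i.+1 == t then F None else class_sum F (~~ side x) i.+1).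
Proof.
have lti := ltn_ord i.
case: ifP => [it|it].
  rewrite -[F None](big_pred1_eq addn None F); apply: sum_pred_split.
  case=> [[y j]|] /=; last by rewrite it.
  have ltj := ltn_ord j.
  by case: x y => [x|x] [y|y] //=; lia.
apply: sum_pred_split; case=> [[y j]|] /=; last by rewrite it.
by case: x y => [x|x] [y|y] //=; lia.
Qed.

Lemma weight_apex {t m n : nat}
    (F : mycielskian t (complete_bipartite m n) -> nat) :
  \sum_(w | @adj (mycielskian t (complete_bipartite m n)) None w) F w =
  class_sum F false t.-1 + class_sum F true t.-1.
Proof.
apply: sum_pred_split; case=> [[y j]|] //=.
by have := ltn_ord j; case: y => y /=; lia.
Qed.

Lemma class_sum_left {t m n : nat}
    (F : mycielskian t (complete_bipartite m n) -> nat) (i : 'I_t) :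
  class_sum F false i = \sum_(x < m) F (Some (inl x, i)).
Proof.
rewrite /class_sum (reindex_omap (fun x : 'I_m => Some (inl x, i))
  (fun w => if w is Some (inl x, _) then Some x else None)) /=.
  by apply: eq_bigl => x; rewrite !eqxx.
by case=> [[[x|x] j]|] //= /eqP /val_inj ->.
Qed.

Lemma class_sum_right {t m n : nat}
    (F : mycielskian t (complete_bipartite m n) -> nat) (i : 'I_t) :
  class_sum F true i = \sum_(x < n) F (Some (inr x, i)).
Proof.
rewrite /class_sum (reindex_omap (fun x : 'I_n => Some (inr x, i))
  (fun w => if w is Some (inr x, _) then Some x else None)) /=.
  by apply: eq_bigl => x; rewrite !eqxx.
by case=> [[[x|x] j]|] //= /eqP /val_inj ->.
Qed.

Lemma sum_classes (t m n : nat)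
    (F : mycielskian t (complete_bipartite m n) -> nat) :
  \sum_w F w =
  F None + \sum_(i < t) (class_sum F false i + class_sum F true i).
Proof.
rewrite (bigD1 None) //=; congr (_ + _).
pose h (w : mycielskian t (complete_bipartite m n)) :=
  if w is Some (_, i) then Some i else None.
rewrite (partition_big h (fun c => c != None)) /=; last by case=> [[]|].
rewrite (reindex_omap Some id) /=; last by case.
apply: eq_big => [i|i _]; first by rewrite !eqxx.
apply: sum_pred_split; case=> [[[y|y] j]|] //=;
  by rewrite /h (inj_eq Some_inj) -val_eqE /= ?addn0.
Qed.

Lemma card_myc (t m n : nat) :
  #|mycielskian t (complete_bipartite m n)| = ((m + n) * t).+1.
Proof. by rewrite card_option card_prod card_sum !card_ord. Qed.

(** On each side the equations propagate from level 0 upwards: the values run [S b 0], [k - S b 0],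
    [k - S b 0], [S b 0], and repeat. The two sides are tied together at the top, by [u] at level
    [t.-2] and by the apex equation at level [t.-1]. *)
Lemma class_sums_equal (t k u : nat) (S : bool -> nat -> nat) :
  3 <= t ->
  (forall b i, i < t ->
     S b i.-1 + (if i.+1 == t then u else S b i.+1) = k) ->
  S false t.-1 + S true t.-1 = k ->
  u * 2 = k /\ forall b i, i < t -> S b i * 2 = k.
Proof.
move=> t3 Sk Sapex.
have S01 b : S b 0 + S b 1 = k by have := Sk b 0; rewrite /=; case: eqP; lia.
have SS b i : i.+2 < t -> S b i + S b i.+2 = k.
  by move=> it; have := Sk b i.+1 (ltnW it); rewrite /=; case: eqP; lia.
have Su b : S b t.-2 + u = k.
  by have := Sk b t.-1; rewrite prednK ?eqxx; lia.
(* The quantifier over [b] stands inside each alternative: the same one holds for both sides, which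
   makes them comparable. *)
pose P i := (forall b, S b i = S b 0) \/ (forall b, S b i + S b 0 = k).
have P2 i : i.+1 < t -> P i /\ P i.+1.
  elim: i => [|i IH] it.
    by split; [left | right => b; have := S01 b; lia].
  have [Pi Pi1] := IH (ltnW it); split=> //.
  by case: Pi => Pi; [right|left] => b; have := SS b i it; have := Pi b; lia.
have PP i : i < t -> P i.
  by case: i => [|i] it; [left | case: (P2 i it)].
(* Both sides equal [k - u] at level [t.-2], and [P] carries this agreement down to level 0. *)
have eq0 : S false 0 = S true 0.
  have := Su false; have := Su true.
  have [||H] := PP t.-2; first lia.
    by move=> H; have := H false; have := H true; lia.
  by have := H false; have := H true; lia.
(* By [eq0] the sides also agree at level [t.-1], where they add up to [k]; so each is half of [k]
   there, and by [P] at level 0. *)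
have half b : S b 0 * 2 = k.
  have [||H] := PP t.-1; first lia.
    by move=> H; have := H false; have := H true; case: b; lia.
  by have := H false; have := H true; case: b; lia.
have all b i : i < t -> S b i * 2 = k.
  by move=> /PP [] H; have := H b; have := half b; lia.
by split=> //; have := all true t.-2; have := Su true; lia.
Qed.

Lemma distance_magic_sizes (t m n : nat) :
  3 <= t -> 1 <= m -> 1 <= n ->
  distance_magic (mycielskian t (complete_bipartite m n)) -> m = 2 /\ n = 2.
Proof.
move=> t3 m1 n1 [f [f_bij [k fk]]].
pose F w := (f w).+1; pose S := class_sum F.
have t0 : 0 < t by lia.
have [||u2 S2] := class_sums_equal t k (F None) S t3.
- move=> b i it.
  (* The classes of one side are seen from a vertex of the other side, which [m1] or [n1]
     supplies. *)
  case: b.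
    by rewrite -(fk (Some (inl (Ordinal m1), Ordinal it))) weight_vertex.
  by rewrite -(fk (Some (inr (Ordinal n1), Ordinal it))) weight_vertex.
- by rewrite -(fk None) weight_apex.
have F_inj : injective F by move=> v w [/val_inj /(bij_inj f_bij)].
pose i0 := Ordinal t0.
have m_neq1 : m <> 1.
  move=> em; subst m; have := S2 false 0 t0.
  rewrite /S (class_sum_left F i0) big_ord1 => H.
  by have /F_inj : F (Some (inl ord0, i0)) = F None by lia.
have n_neq1 : n <> 1.
  move=> en; subst n; have := S2 true 0 t0.
  rewrite /S (class_sum_right F i0) big_ord1 => H.
  by have /F_inj : F (Some (inr ord0, i0)) = F None by lia.
have tot : \sum_w F w = F None + t * k.
  rewrite sum_classes; congr (_ + _).
  rewrite -[t in RHS]card_ord -sum_nat_const; apply: eq_bigr => i _.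
  have := S2 true i (ltn_ord i).
  by have := S2 false i (ltn_ord i); rewrite /S; lia.
have := sum_index_bij _ f f_bij; rewrite -/F tot => sumN.
have : F None <= #|mycielskian t (complete_bipartite m n)| by apply: ltn_ord.
move: sumN; rewrite !card_myc => sumN uN.
(* With [N = (m + n) * t + 1], [sumN] and [u2] give [N * (N + 1) = 2 * (2 * t + 1) * F None]; bound
   [F None] by [N] and cancel [N]. *)
have : ((m + n) * t).+2 <= 2 * (2 * t).+1.
  rewrite -(@leq_pmul2l ((m + n) * t).+1) // -sumN; nia.
have : m + n <= 4 -> m = 2 /\ n = 2 by lia.
by move=> H H1; apply: H; nia.
Qed.

(** Labels are counted from 0 here, so the apex value stands for [N = 4 * t + 1]. The classes are
    numbered by [p < 2 * t], even on the left and odd on the right. *)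
Definition pair_label {t : nat} (w : mycielskian t (complete_bipartite 2 2)) :=
  match w with
  | None => 4 * t
  | Some (x, i) =>
      let: (p, first) := match x with
                         | inl a => (2 * i, a == 0 :> nat)
                         | inr a => ((2 * i).+1, a == 0 :> nat)
                         end in
      if first then p else 4 * t - p.+1
  end.

Lemma pair_label_lt {t : nat} (w : mycielskian t (complete_bipartite 2 2)) :
  pair_label w < #|mycielskian t (complete_bipartite 2 2)|.
Proof.
rewrite card_myc; case: w => [[[a|a] i]|] /=; last by lia.
all: by have := ltn_ord i; case: ifP; lia.
Qed.

(** First vertices get values below [2 * t], second ones values from [2 * t] to [4 * t - 1]; then
    [p] gives the side by its parity, and the level. *)
Lemma pair_label_inj (t : nat) : injective (@pair_label t).
Proof.
case=> [[[a|a] i]|] [[[b|b] j]|] //=;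
  try have lti := ltn_ord i; try have ltj := ltn_ord j;
  do ?case: ifP => ?; move=> *; try lia.
all: have -> : a = b
  by apply: val_inj => /=; have := ltn_ord a; have := ltn_ord b; lia.
all: by have -> // : i = j by apply: val_inj => /=; lia.
Qed.

Lemma distance_magic_22 (t : nat) :
  0 < t -> distance_magic (mycielskian t (complete_bipartite 2 2)).
Proof.
move=> t0; pose f w := Ordinal (@pair_label_lt t w).
have f_inj : injective f by move=> v w [/pair_label_inj].
exists f; split; first by apply: inj_card_bij; rewrite ?card_ord.
(* A neighbourhood is two classes, or a class and the apex, and each of these has sum [N]. *)
exists (2 * (4 * t).+1).
pose F w := (f w).+1.
have S_eq b i : i < t -> class_sum F b i = (4 * t).+1.
  move=> it; case: b.
    rewrite (class_sum_right F (Ordinal it)) big_ord_recl big_ord1.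
    by rewrite /F /=; lia.
  rewrite (class_sum_left F (Ordinal it)) big_ord_recl big_ord1.
  by rewrite /F /=; lia.
case=> [[x i]|]; last by rewrite (weight_apex F) !S_eq; lia.
have lti := ltn_ord i.
rewrite (weight_vertex F) S_eq; last by lia.
by case: eqP => it; [rewrite /F /=|rewrite S_eq]; lia.
Qed.

Theorem theorem2p12 (t m n : nat) (ht : 3 <= t) (hm : 1 <= m) (hn : 1 <= n) :
  distance_magic (mycielskian t (complete_bipartite m n)) <-> m = 2 /\ n = 2.
Proof.
split; first exact: distance_magic_sizes.
by case=> -> ->; apply: distance_magic_22; lia.
Qed.
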